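(* For $d=4$ and $k=2$ we have $S(4,2)=5$, and the strong parity property holds for $puz[4,2,S(4,2)]$.
   Context: Let $d\ge 1$, $1\le k\le d$, $1\le l\le 2^d$ be integers. $Q^d$ is the graph of vertices and edges of the $d$-dimensional cube, with vertex set $\{0,1\}^d$. A $k$-dimensional face ($k$-face) of $Q^d$ is a set of $2^k$ vertices obtained by fixing $d-k$ of the coordinates. $\mathcal{C}[d,l]$ is the set of all configurations of $2^d-l$ tokens, labeled $1,\dots,2^d-l$, placed on distinct vertices of $Q^d$ (so $l$ vertices are unoccupied). For a configuration $C$, $\mathcal L_C=\{1,\dots,2^d-l\}$ is its set of labels (tokens). Moves: if a token $t$ sits at a vertex of a $k$-face $\sigma$ and all remaining vertices of $\sigma$ are unoccupied, then $t$ can be moved to any other vertex of $\sigma$; this is called a $k$-move. The puzzle graph $puz[d,k,l]$ has vertex set $\mathcal{C}[d,l]$, with $C$ and $D$ joined by an edge when one is reached from the other by a single $k$-move. A configuration $C$ is $k$-isolated if no token can perform a $k$-move; it is $k$-semi-isolated if there is a non-empty proper subset $\mathcal A_C\subsetneq\mathcal L_C$ such that every configuration in the connected component of $C$ in $puz[d,k,l]$ is obtained from $C$ by a series of $k$-moves affecting only tokens in $\mathcal L_C\setminus\mathcal A_C$; it is $k$-mobile if it is neither $k$-isolated nor $k$-semi-isolated. $puz[d,k,l]$ has the strong parity property if it has exactly two connected components containing $k$-mobile configurations. A configuration is obtained from $C$ by a permutation $g$ if it has the same occupied vertices and the labels are permuted by $g$. $puz[d,k,l]$ has the even solvability property if there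 is a configuration $C\in\mathcal C[d,l]$ such that all configurations obtained from $C$ by an even permutation of the labels lie in the same connected component of $puz[d,k,l]$ as $C$. $S(d,k)$ is the minimum integer $l$ such that $puz[d,k,l]$ has the even solvability property. *)

(* Defs.v *)
From HB Require Import structures.
From mathcomp Require Import all_boot all_fingroup.

Set Implicit Arguments.
Unset Strict Implicit.
Unset Printing Implicit Defensive.

Notation vertex d := {ffun 'I_d -> bool}.

(* Tokens are numbered from 0 rather than from 1. *)
Notation token d l := 'I_(2 ^ d - l).

(* The subface of the cube through [v] on which the coordinates in [S] are
   fixed; for k <= d it is a k-face when [S] has [d - k] elements. *)
Definition fix_coords d (S : {set 'I_d}) (v : vertex d) : {set vertex d} :=
  [set x : vertex d | [forall i in S, x i == v i]].

Definition is_face d k (F : {set vertex d}) : bool :=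
  [exists S : {set 'I_d}, exists v : vertex d,
    (#|S| == d - k) && (F == fix_coords S v)].

Record config d l := Config {
  config_fun :> {ffun token d l -> vertex d};
  config_inj : injectiveb config_fun }.

HB.instance Definition _ d l := [isSub for @config_fun d l].
HB.instance Definition _ d l := [Finite of config d l by <:].

Definition kmove d k l (t : token d l) (C D : config d l) : bool :=
  [exists F : {set vertex d},
    [&& is_face k F, C t \in F, D t \in F, D t != C t,
        [forall s : token d l, (s != t) ==> (C s \notin F)] &
        [forall s : token d l, (s != t) ==> (D s == C s)]]].

Definition puz d k l : rel (config d l) :=
  [rel C D | [exists t : token d l, kmove k t C D]].

Lemma puz_sym d k l : symmetric (@puz d k l).
Proof.
suff sub C D : @puz d k l C D -> puz k D C.
  by move=> C D; apply/idP/idP; apply: sub.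
case/existsP=> t /existsP[F /and3P[faceF Ct /and4P[Dt neq offF fixed]]].
apply/existsP; exists t; apply/existsP; exists F; rewrite faceF Ct Dt eq_sym neq /=.
apply/andP; split; apply/forallP=> s; apply/implyP=> st.
  by rewrite (eqP (implyP (forallP fixed s) st)) (implyP (forallP offF s) st).
by rewrite eq_sym (implyP (forallP fixed s) st).
Qed.

Definition component d k l (C : config d l) : {set config d l} :=
  [set D | connect (@puz d k l) C D].

Definition isolated d k l (C : config d l) : bool :=
  [forall t : token d l, forall D : config d l, ~~ kmove k t C D].

Definition puz_avoiding d k l (A : {set token d l}) : rel (config d l) :=
  [rel C D | [exists t in ~: A, kmove k t C D]].

Definition semi_isolated d k l (C : config d l) : bool :=
  [exists A : {set token d l},
    [&& A != set0, A \proper [set: token d l] &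
        [forall D in component k C, connect (puz_avoiding k A) C D]]].

Definition mobile d k l (C : config d l) : bool :=
  ~~ isolated k C && ~~ semi_isolated k C.

Definition strong_parity d k l : bool :=
  #|[set component k C | C : config d l & mobile k C]| == 2.

Fact relabel_inj d l (g : {perm token d l}) (C : config d l) :
  injectiveb [ffun t => C (g t)].
Proof.
apply/injectiveP=> s t; rewrite !ffunE => /(injectiveP _ (config_inj C)).
exact: perm_inj.
Qed.

(* Same occupied vertices as [C]; token [t] takes the place of token [g t]. *)
Definition relabel d l (g : {perm token d l}) (C : config d l) : config d l :=
  Config (relabel_inj g C).

Definition even_solvable d k l : bool :=
  [exists C : config d l, forall g : {perm token d l},
    ~~ odd_perm g ==> (relabel g C \in component k C)].

Fact even_solvable_exists d k :
  exists l, (1 <= l <= 2 ^ d) && even_solvable d k l.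
Proof.
exists (2 ^ d); rewrite leqnn expn_gt0 /=.
have no_token (t : token d (2 ^ d)) : False by case: t => m; rewrite subnn.
pose f : {ffun token d (2 ^ d) -> vertex d} := [ffun=> [ffun=> false]].
have f_inj : injectiveb f by apply/injectiveP=> t; case: (no_token t).
apply/existsP; exists (Config f_inj); apply/forallP=> g; apply/implyP=> _.
suff -> : relabel g (Config f_inj) = Config f_inj by rewrite inE connect0.
by apply/val_inj/ffunP=> t; case: (no_token t).
Qed.

(* The number written S(d,k); the name S is left to the successor of nat. *)
Definition Smin d k : nat := ex_minn (even_solvable_exists d k).

(* Main.v *)
Require Import Defs.
From mathcomp Require Import all_boot all_fingroup zify.

(* Number the vertices of the 4-cube from 0 to 15 and record which of them are
   occupied.  The moves act on these occupation masks, and up to five empty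
   vertices there are few enough masks for a kernel computation to show:
   - with five empty vertices, there is one class of 2288 masks that are
     connected to each other, and these masks carry signs such that the parity
     of the arrangement of the tokens, corrected by the sign of the mask, is
     invariant under moves;
   - for every other mask (in particular with at most four empty vertices),
     all moves are confined for ever to a facet or a 2-face, so that some token
     is frozen.
   A frozen token rules out even solvability and mobility.  On the large class,
   the explicit 3-cycles (0 1 i) generate the alternating group, hence all even
   permutations are realized, and the invariant separates the two parities. *)

Set Implicit Arguments.
Unset Strict Implicit.
Unset Printing Implicit Defensive.

(** * Faces, masks and moves on the numbered vertices of the 4-cube *)

Definition bit (i x : nat) : bool := odd (iter i half x).

Definition face (i j : nat) (a b : bool) : seq nat :=
  [seq x <- iota 0 16 | (bit i x == a) && (bit j x == b)].

Definition faces : seq (seq nat) :=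
  [seq face p.1 p.2 q.1 q.2
     | p <- [:: (0, 1); (0, 2); (0, 3); (1, 2); (1, 3); (2, 3)],
       q <- [:: (false, false); (false, true); (true, false); (true, true)]].

Definition facets : seq (seq nat) :=
  [seq [seq x <- iota 0 16 | bit i x == a]
     | i <- [:: 0; 1; 2; 3], a <- [:: false; true]].

Definition bits (s : seq nat) : bitseq := [seq x \in s | x <- iota 0 16].

(* Moves are pairs (old vertex, new vertex). *)
Definition face_moves (b : bitseq) (F : seq nat) : seq (nat * nat) :=
  if [seq x <- F | nth false b x] is [:: u]
  then [seq (u, w) | w <- F & w != u] else [::].

Definition moves (b : bitseq) : seq (nat * nat) :=
  flatten [seq face_moves b F | F <- faces].

Definition flip (m : nat * nat) (b : bitseq) : bitseq :=
  set_nth false (set_nth false b m.1 false) m.2 true.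

Definition step (m : nat * nat) (s : seq nat) : seq nat :=
  [seq if x == m.1 then m.2 else x | x <- s].

Lemma face_uniq i j a b : uniq (face i j a b).
Proof. exact/filter_uniq/iota_uniq. Qed.

Lemma mem_face i j a b x :
  (x \in face i j a b) = [&& x < 16, bit i x == a & bit j x == b].
Proof. by rewrite mem_filter mem_iota add0n andbC. Qed.

Lemma face_in_faces (i j : 'I_4) a b : i != j -> face i j a b \in faces.
Proof.
wlog lt_ij: i j a b / i < j => [base | _].
  rewrite neq_ltn => /orP[] lt_ij; first by rewrite base // neq_ltn lt_ij.
  suff -> : face i j a b = face j i b a by rewrite base // neq_ltn lt_ij.
  by apply: eq_filter => x; rewrite andbC.
apply/allpairsP; exists (nat_of_ord i, nat_of_ord j, (a, b)); split=> //=.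
  by case: i j lt_ij => [[|[|[|[|i]]]] ?] [[|[|[|[|j]]]] ?].
by case: a b => [] [].
Qed.

Lemma facesP F : F \in faces ->
  exists i j : 'I_4, exists a b, i != j /\ F = face i j a b.
Proof.
case/allpairsP=> [[[i j] [a b]] [ij _ ->]] /=.
have [lt_i lt_j neq_ij] : [/\ i < 4, j < 4 & i != j].
  by move: ij; rewrite !inE => /or4P[| | |/or3P[]] /eqP[-> ->].
by exists (Ordinal lt_i), (Ordinal lt_j), a, b.
Qed.

Lemma size_bits s : size (bits s) = 16.
Proof. by rewrite size_map size_iota. Qed.

Lemma nth_bits s x : x < 16 -> nth false (bits s) x = (x \in s).
Proof. by move=> lt_x; rewrite (nth_map 0) ?size_iota // nth_iota. Qed.

Lemma movesP b u w :
  reflect (exists F, [/\ F \in faces, w \in F, w != u &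
             [seq x <- F | nth false b x] = [:: u]])
          ((u, w) \in moves b).
Proof.
apply: (iffP flattenP) => [[_ /mapP[F inF ->]] | [F [inF Fw neq_wu def_u]]].
  rewrite /face_moves; case def_u: [seq _ <- _ | _] => [|y [|? ?]] //.
  case/mapP=> z; rewrite mem_filter => /andP[neq Fz] [-> ->].
  by exists F.
exists (face_moves b F); first exact: map_f.
by rewrite /face_moves def_u; apply: map_f; rewrite mem_filter neq_wu.
Qed.

(** The origin must be occupied: otherwise [step] changes nothing while [flip] still fills the
    target. *)
Lemma bits_step m s :
  all (gtn 16) s -> m.1 \in s -> m.2 < 16 -> m.2 != m.1 ->
  bits (step m s) = flip m (bits s).
Proof.
case: m => u w /= /allP lt_s su lt_w neq.
have lt_u : u < 16 by apply: lt_s.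
apply: (@eq_from_nth _ false).
  by rewrite !size_set_nth !size_bits !(maxn_idPr _).
move=> x; rewrite size_bits => lt_x.
rewrite nth_bits // !nth_set_nth /= nth_set_nth /= nth_bits //.
apply/mapP/idP => [[y sy ->] | ].
  case: (y =P u) => [_|/eqP y_u]; first by rewrite eqxx.
  by rewrite (negPf y_u) sy if_same.
case: (x =P w) => [-> _|_]; first by exists u; rewrite ?eqxx.
by case: (x =P u) => // /eqP x_u sx; exists x; rewrite ?(negPf x_u).
Qed.

(** * Binary coding of vertices and configurations *)

Definition code (v : vertex 4) : nat := \sum_(i < 4) v i * 2 ^ i.
Definition decode (x : nat) : vertex 4 := [ffun i : 'I_4 => bit i x].

Lemma bit_code (v : vertex 4) (i : 'I_4) : bit i (code v) = v i.
Proof.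
rewrite /code !big_ord_recl big_ord0.
have -> : v i = nth false [:: v ord0; v (lift ord0 ord0);
    v (lift ord0 (lift ord0 ord0));
    v (lift ord0 (lift ord0 (lift ord0 ord0)))] i.
  by case: i => [[|[|[|[|i]]]] lt_i] //=; congr (v _); apply: val_inj.
case: (v _) (v _) (v _) (v _) => [] [] [] [];
  by case: i => [[|[|[|[|i]]]] lt_i].
Qed.

Lemma codeK : cancel code decode.
Proof. by move=> v; apply/ffunP=> i; rewrite ffunE bit_code. Qed.

Lemma code_inj : injective code. Proof. exact: can_inj codeK. Qed.

Lemma code_lt v : code v < 16.
Proof.
rewrite /code !big_ord_recl big_ord0.
by case: (v _) (v _) (v _) (v _) => [] [] [] [].
Qed.

Lemma decodeK x : x < 16 -> code (decode x) = x.
Proof.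
rewrite /code !big_ord_recl big_ord0 !ffunE /=.
by do 16?[case: x => [|x] //].
Qed.

Lemma config_fun_inj d l (C : config d l) : injective C.
Proof. exact/injectiveP/config_inj. Qed.

Definition pos l (C : config 4 l) : seq nat :=
  [seq code (C t) | t <- enum 'I_(2 ^ 4 - l)].

Lemma size_pos l (C : config 4 l) : size (pos C) = 2 ^ 4 - l.
Proof. by rewrite size_map size_enum_ord. Qed.

Lemma nth_pos l (C : config 4 l) (t : token 4 l) : nth 0 (pos C) t = code (C t).
Proof. by rewrite (nth_map t) ?size_enum_ord // nth_ord_enum. Qed.

Lemma posP l (C : config 4 l) x :
  reflect (exists t, x = code (C t)) (x \in pos C).
Proof.
by apply: (iffP mapP) => [[t _ ->]|[t ->]]; exists t; rewrite ?mem_enum.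
Qed.

Lemma pos_uniq l (C : config 4 l) : uniq (pos C).
Proof.
rewrite map_inj_uniq ?enum_uniq // => s t /code_inj.
exact: config_fun_inj.
Qed.

Lemma pos_lt l (C : config 4 l) : all (gtn 16) (pos C).
Proof. by apply/allP=> _ /posP[t ->]; apply: code_lt. Qed.

Lemma pos_inj l (C D : config 4 l) : pos C = pos D -> C = D.
Proof.
move=> eq_pos; apply/val_inj/ffunP=> t; apply: code_inj.
by rewrite -!nth_pos eq_pos.
Qed.

Lemma of_pos l s : size s = 2 ^ 4 - l -> uniq s -> all (gtn 16) s ->
  exists C : config 4 l, pos C = s.
Proof.
move=> sz_s uniq_s /allP lt_s.
have lt (t : token 4 l) : nth 0 s t < 16 by apply/lt_s/mem_nth; rewrite sz_s.
have C_inj : injectiveb [ffun t : token 4 l => decode (nth 0 s t)].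
  apply/injectiveP=> t1 t2; rewrite !ffunE => /(congr1 code).
  rewrite !decodeK // => /eqP; rewrite nth_uniq ?sz_s // => /eqP.
  exact: val_inj.
exists (Config C_inj); apply: (@eq_from_nth _ 0); first by rewrite size_pos.
move=> x; rewrite size_pos => lt_x.
by rewrite -[x]/(nat_of_ord (Ordinal lt_x)) nth_pos ffunE decodeK.
Qed.

(** * Correspondence of puzzle moves and mask moves *)

Lemma is_face2P (F : {set vertex 4}) :
  reflect (exists i j : 'I_4, exists v : vertex 4,
             i != j /\ forall x, (x \in F) = (x i == v i) && (x j == v j))
          (is_face 2 F).
Proof.
have in_fix i j (v x : vertex 4) :
    (x \in fix_coords [set i; j] v) = (x i == v i) && (x j == v j).
  rewrite inE; apply/forall_inP/andP => [fix_v | [xi xj] k].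
    by split; apply: fix_v; rewrite !inE eqxx ?orbT.
  by rewrite !inE => /orP[] /eqP->.
apply: (iffP existsP) => [[S /existsP[v /andP[/cards2P[i [j]]]]] | ].
  by case=> neq -> /eqP->; exists i, j, v.
case=> i [j [v [neq inF]]]; exists [set i; j]; apply/existsP; exists v.
by rewrite cards2 neq; apply/eqP/setP=> x; rewrite inF in_fix.
Qed.

Lemma kmove_pos l t (C D : config 4 l) : kmove 2 t C D ->
  (code (C t), code (D t)) \in moves (bits (pos C)) /\
  pos D = step (code (C t), code (D t)) (pos C).
Proof.
case/existsP=> F /and5P[/is_face2P[i [j [v [neq_ij inF]]]] Ct Dt neq].
case/andP=> /forallP offF /forallP fixed; split; last first.
  rewrite /step -map_comp; apply/eq_map => s /=.
  rewrite (inj_eq code_inj) (inj_eq (@config_fun_inj _ _ C)).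
  case: (s =P t) => [->//|/eqP st].
  by rewrite (eqP (implyP (fixed s) st)).
have mem x : (code x \in face i j (v i) (v j)) = (x \in F).
  by rewrite mem_face code_lt !bit_code inF.
apply/movesP; exists (face i j (v i) (v j)); split.
- exact: face_in_faces.
- by rewrite mem.
- by rewrite (inj_eq code_inj).
rewrite -(filter_pred1_uniq (face_uniq i j (v i) (v j))) ?mem //.
apply: eq_in_filter => x /=; rewrite mem_face => /and3P[lt_x xi xj].
rewrite nth_bits //; apply/posP/eqP => [[s def_x]|->]; last by exists t.
rewrite def_x; congr (code (C _)); apply/eqP; apply: contraT => st.
have /negP[] := implyP (offF s) st.
by rewrite -mem -def_x mem_face lt_x xi.
Qed.

Lemma puz_pos l (C D : config 4 l) : puz 2 C D ->
  exists2 m, m \in moves (bits (pos C)) & pos D = step m (pos C).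
Proof.
case/existsP=> t /kmove_pos[in_m eq_pos].
by exists (code (C t), code (D t)).
Qed.

Lemma moves_pos l (C : config 4 l) m : m \in moves (bits (pos C)) ->
  [/\ m.1 \in pos C, m.2 \notin pos C, m.2 < 16 & m.2 != m.1].
Proof.
case: m => u w /= /movesP[F [/facesP[i [j [a [b [_ ->]]]]] Fw neq def_u]].
have lt_w : w < 16 by move: Fw; rewrite mem_face => /and3P[].
have : u \in [seq x <- face i j a b | nth false (bits (pos C)) x].
  by rewrite def_u mem_head.
rewrite mem_filter mem_face => /and3P[+ lt_u _]; rewrite nth_bits // => ->.
split=> //; apply/negP=> Cw.
have : w \in [seq x <- face i j a b | nth false (bits (pos C)) x].
  by rewrite mem_filter Fw nth_bits // Cw.
by rewrite def_u inE (negPf neq).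
Qed.

Lemma bits_pos_step l (C : config 4 l) m : m \in moves (bits (pos C)) ->
  bits (step m (pos C)) = flip m (bits (pos C)).
Proof. by case/moves_pos=> *; apply: bits_step; rewrite ?pos_lt. Qed.

(** Converse of [puz_pos]: the token on [m.1] is alone on a face containing [m.2]. *)
Lemma puz_step l (C : config 4 l) m : m \in moves (bits (pos C)) ->
  exists2 D, puz 2 C D & pos D = step m (pos C).
Proof.
move=> in_m; have [/posP[t def_u] free lt_w neq] := moves_pos in_m.
have [D eq_pos] : exists D : config 4 l, pos D = step m (pos C).
  apply: of_pos; first by rewrite size_map size_pos.
    rewrite map_inj_in_uniq ?pos_uniq // => x y Cx Cy.
    case: eqP => [->|_]; case: eqP => [->|_] // eq_w.
      by rewrite -eq_w (negPf free) in Cy.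
    by rewrite eq_w (negPf free) in Cx.
  apply/allP=> _ /mapP[y Cy ->]; case: ifP => _ //.
  exact: (allP (pos_lt C)).
have Dfun s : code (D s) = if s == t then m.2 else code (C s).
  rewrite -nth_pos eq_pos (nth_map 0) ?size_pos // nth_pos def_u.
  by rewrite (inj_eq code_inj) (inj_eq (@config_fun_inj _ _ C)).
exists D => //; apply/existsP; exists t; apply/existsP.
case: m in_m def_u neq {free lt_w eq_pos} Dfun => u w.
case/movesP=> F [inF Fw _ def_u] /= u_t neq Dfun.
have Dt : code (D t) = w by rewrite Dfun eqxx.
have [i [j [a [b [neq_ij def_F]]]]] := facesP inF.
exists [set x | code x \in F].
have in_filter x : x \in F -> x \in pos C -> x = u.
  move=> Fx Cx; have : x \in [seq x <- F | nth false (bits (pos C)) x].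
    by rewrite mem_filter Fx nth_bits ?Cx //; apply: (allP (pos_lt C)).
  by rewrite def_u inE => /eqP.
have Fu : u \in F.
  have : u \in [seq x <- F | nth false (bits (pos C)) x].
    by rewrite def_u mem_head.
  by rewrite mem_filter => /andP[].
apply/and5P; split.
- apply/is_face2P; exists i, j, (C t); split=> // x.
  rewrite inE def_F mem_face code_lt !bit_code.
  by move: Fu; rewrite def_F u_t mem_face !bit_code => /and3P[_ /eqP-> /eqP->].
- by rewrite inE -u_t.
- by rewrite inE Dt.
- by rewrite -(inj_eq code_inj) Dt -u_t.
apply/andP; split; apply/forallP=> s; apply/implyP=> st.
  rewrite inE; apply: contra st => Fs.
  apply/eqP/(@config_fun_inj _ _ C)/code_inj.
  by rewrite -u_t; apply: in_filter => //; apply/posP; exists s.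
by apply/eqP/code_inj; rewrite Dfun (negPf st).
Qed.

(** * Parity of the number of inversions, and its change under a move *)

Fixpoint inv_parity (s : seq nat) : bool :=
  if s is x :: s' then odd (count (gtn x) s') (+) inv_parity s' else false.

(* A move changes the order of the moved token relative to the tokens on the
   vertices strictly between its endpoints, hence [inv_parity] by the parity
   of their number. *)
Definition between (m : nat * nat) : seq nat :=
  iota (minn m.1 m.2).+1 (maxn m.1 m.2 - (minn m.1 m.2).+1).

Definition msign (b : bitseq) (m : nat * nat) : bool :=
  odd (count (nth false b) (between m)).

Lemma mem_between u w x : x != u -> x != w ->
  (x \in between (u, w)) = (x < u) (+) (x < w).
Proof.
rewrite mem_iota /=.
by case: (ltngtP u w); case: (ltngtP x u); case: (ltngtP x w) => //=; lia.
Qed.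

Lemma step_notin u w s : u \notin s -> step (u, w) s = s.
Proof.
move=> su; rewrite -[RHS]map_id; apply/eq_in_map=> x sx /=.
by case: eqP => // x_u; rewrite -x_u sx in su.
Qed.

Lemma step_cons u w x s :
  step (u, w) (x :: s) = (if x == u then w else x) :: step (u, w) s.
Proof. by []. Qed.

(** Only the moved entry can change sides of [x], exactly when [x] separates [u] and [w]. *)
Lemma odd_count_step u w x s :
  uniq s -> u \in s -> w \notin s -> x != u -> x != w ->
  odd (count (gtn x) (step (u, w) s)) =
  odd (count (gtn x) s) (+) (x \in between (u, w)).
Proof.
move=> uniq_s su sw xu xw; rewrite mem_between //.
elim: s uniq_s su sw => // y s IHs; rewrite cons_uniq => /andP[sy uniq_s].
rewrite step_cons !inE eq_sym negb_or => su /andP[wy sw].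
case: (y =P u) su => [y_u _|_] /=; last first.
  by move=> su; rewrite !oddD IHs // addbA.
rewrite step_notin -?y_u // !oddD !oddb.
have ->: (y < x) = ~~ (x < y) by rewrite y_u; case: ltngtP xu.
have ->: (w < x) = ~~ (x < w) by case: ltngtP xw.
by do 2!case: (_ < _); case: (odd _).
Qed.

Lemma odd_count_lt u w s : u \notin s -> w \notin s ->
  odd (count (gtn w) s) =
  odd (count (gtn u) s) (+) odd (count [in between (u, w)] s).
Proof.
elim: s => //= y s IHs; rewrite !inE !negb_or => /andP[uy su] /andP[wy sw].
rewrite !oddD IHs // !oddb mem_between; try by rewrite eq_sym.
by do 2!case: (_ < _) => //=; do 2!case: (odd _).
Qed.

(** A moved head is compared anew with the whole tail ([odd_count_lt]), a fixed head only with the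
    moved entry ([odd_count_step]). *)
Lemma inv_parity_step u w s : uniq s -> u \in s -> w \notin s ->
  inv_parity (step (u, w) s) =
  inv_parity s (+) odd (count [in between (u, w)] s).
Proof.
elim: s => // x s IHs; rewrite cons_uniq !inE negb_or => /andP[sx uniq_s].
rewrite eq_sym step_cons => su /andP[wx sw].
case: (x =P u) su => [x_u _|/eqP x_u su] /=.
  have -> : (x \in between (u, w)) = false by rewrite x_u mem_iota /=; lia.
  rewrite step_notin -?x_u // (@odd_count_lt x) //.
  rewrite add0n.
  by case: (odd (count _ _)) (inv_parity s) (odd (count _ _)) => [] [] [].
rewrite odd_count_step // 1?eq_sym // IHs // oddD oddb.
by rewrite addbACA.
Qed.

Lemma count_mem_swap (T : eqType) (s t : seq T) : uniq s -> uniq t ->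
  count [in s] t = count [in t] s.
Proof.
move=> uniq_s uniq_t; rewrite -!size_filter; apply/perm_size/uniq_perm.
- exact: filter_uniq.
- exact: filter_uniq.
by move=> x; rewrite !mem_filter andbC.
Qed.

(** * Search for signed masks and exhaustive check *)

Inductive trie := Empty | Trie of option bool & trie & trie.

(** One step per bit, whatever the number of recorded masks, keeps the kernel computation
    feasible. *)
Fixpoint lookup (t : trie) (b : bitseq) : option bool :=
  match t, b with
  | Empty, _ => None
  | Trie o _ _, [::] => o
  | Trie _ l r, x :: b' => lookup (if x then r else l) b'
  end.

Fixpoint insert (b : bitseq) (e : bool) (t : trie) : trie :=
  let: (o, l, r) :=
    if t is Trie o l r then (o, l, r) else (None, Empty, Empty) in
  match b with
  | [::] => Trie (Some e) l r
  | x :: b' => if x then Trie o l (insert b' e r) else Trie o (insert b' e l) r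
  end.

Lemma lookup_insert b e t c :
  lookup (insert b e t) c = if c == b then Some e else lookup t c.
Proof.
by elim: b t c => [|[] b IHb] [|o l r] [|[] c] //=; rewrite IHb.
Qed.

(** Depth-first search with fuel [n], each mask keeping its first sign. Closure under moves and
    consistency of signs are certified afterwards by [masks_ok]. *)
Fixpoint explore (n : nat) (t : trie) (q : seq (bitseq * bool)) : trie :=
  match n, q with
  | n'.+1, (b, e) :: q' =>
      if lookup t b is Some _ then explore n' t q'
      else explore n' (insert b e t)
             ([seq (flip m b, e (+) msign b m) | m <- moves b] ++ q')
  | _, _ => t
  end.

Lemma explore_ind (P : bitseq -> Prop) :
  (forall b m, P b -> m \in moves b -> P (flip m b)) ->
  forall n t q, (forall b, lookup t b -> P b) -> {in q, forall x, P x.1} ->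
  forall b, lookup (explore n t q) b -> P b.
Proof.
move=> Pflip; elim=> [|n IHn] t [|[c e] q] //= Pt Pq.
have Pc : P c by apply: (Pq (c, e)); rewrite mem_head.
have{} Pq : {in q, forall x, P x.1}.
  by move=> x qx; apply: Pq; rewrite inE qx orbT.
case: (lookup t c) => [_|]; apply: IHn => // [b | x].
  by rewrite lookup_insert; case: (b =P c) => [->|_ /Pt].
by rewrite mem_cat => /orP[/mapP[m cm ->] | /Pq //]; apply: Pflip.
Qed.

(** [m] is a budget of [false] bits: [all_bits 16 5] tests the 6885 masks with at most five holes
    instead of all 65536. *)
Fixpoint all_bits (n m : nat) (P : bitseq -> bool) : bool :=
  if n is n'.+1 then
    all_bits n' m (fun b => P (true :: b)) &&
    (if m is m'.+1 then all_bits n' m' (fun b => P (false :: b)) else true)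
  else P [::].

Lemma all_bitsP n m P b :
  all_bits n m P -> size b = n -> count negb b <= m -> P b.
Proof.
elim: n m P b => [|n IHn] m P [|x b] //= /andP[Ptrue Pfalse] [sz_b].
case: x => /=; first exact: (IHn m (fun b => P (true :: b))).
case: m Pfalse {Ptrue} => // m Pfalse.
exact: (IHn m (fun b => P (false :: b))).
Qed.

(** The empty vertices 3, 5, 6, 7 and 15 are vertex 7 and its four neighbours. *)
Definition start : seq nat := [:: 0; 1; 2; 4; 8; 9; 10; 11; 12; 13; 14].

(* The value at a mask is the sign that corrects [inv_parity].  The table is
   locked, as unification would otherwise run the search. *)
Definition signs : trie :=
  locked (explore (150 * 150) Empty [:: (bits start, false)]).

(* For a mask outside the table [signs], no move ever leaves its [region]. *)
Definition region (b : bitseq) : seq nat :=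
  head [::]
    ([seq K <- facets | all (fun x => (x \in K) || nth false b x) (iota 0 16)]
     ++ [seq F <- faces | count (nth false b) F == 1]).

(** Both alternatives persist along paths: signed masks stay signed, with signs following [msign];
    unsigned ones stay unsigned and keep a [region] that misses some token. *)
Definition mask_ok (t : trie) (b : bitseq) : bool :=
  if lookup t b is Some e then
    all (fun m => lookup t (flip m b) == Some (e (+) msign b m)) (moves b)
  else
    let K := region b in
    all (fun m => [&& m.1 \in K, region (flip m b) == K
                    & lookup t (flip m b) == None]) (moves b)
    && has (fun x => nth false b x && (x \notin K)) (iota 0 16).

Lemma masks_ok : all_bits 16 5 (mask_ok signs).
Proof. by rewrite /signs -lock; vm_compute. Qed.

Lemma signs_start : lookup signs (bits start) = Some false.
Proof. by rewrite /signs -lock; vm_compute. Qed.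

(** * Explicit walks realizing 3-cycles *)

Fixpoint walk (w : seq (nat * nat)) (s : seq nat) : option (seq nat) :=
  if w is m :: w' then
    if m \in moves (bits s) then walk w' (step m s) else None
  else Some s.

Definition swap0 (i x : nat) : nat :=
  if x == 0 then i else if x == i then 0 else x.

(* Permutes the tokens on vertices 0, 1 and 2 of [start] cyclically. *)
Definition rotation : seq (nat * nat) :=
  [:: (1, 3); (4, 7); (0, 1); (2, 0); (7, 4); (3, 2)].

(* Found by breadth-first search: entry [i - 2] brings token [i] to vertex 2,
   and leaves tokens 0 and 1 and the set of empty vertices in place. *)
Definition carries : seq (seq (nat * nat)) :=
  [:: [::];
   [:: (4, 6); (13, 7); (12, 4); (14, 12); (7, 13); (11, 7); (10, 14);
       (2, 10); (7, 11); (6, 2)];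
   [:: (2, 3); (4, 5); (0, 4); (14, 7); (10, 6); (8, 2); (12, 10); (4, 0);
       (10, 8); (6, 12); (11, 10); (7, 14); (3, 11); (5, 4)];
   [:: (1, 5); (11, 7); (9, 3); (13, 11); (5, 1); (11, 9); (7, 13); (14, 7);
       (10, 11); (2, 10); (7, 14); (3, 2)];
   [:: (2, 6); (11, 7); (10, 2); (14, 10); (7, 11); (6, 14)];
   [:: (11, 3); (14, 7); (10, 11); (2, 10); (7, 14); (3, 2)];
   [:: (14, 15); (4, 7); (12, 6); (13, 4); (15, 12); (7, 13); (11, 7);
       (10, 14); (2, 10); (7, 11); (6, 2)];
   [:: (13, 15); (1, 7); (9, 13); (11, 9); (7, 1); (15, 3); (14, 7); (10, 11);
       (2, 10); (7, 14); (3, 2)];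
   [:: (14, 6); (11, 7); (10, 14); (2, 10); (7, 11); (6, 2)]].

(** Reversing the order and direction of the moves undoes [v], so a carry of token [i] turns the
    rotation into a 3-cycle of tokens 0, 1 and [i]. *)
Definition conjugate (v : seq (nat * nat)) : seq (nat * nat) :=
  v ++ rotation ++ rev [seq (m.2, m.1) | m <- v].

(** The range [iota 2 9] is tokens 2 to 10; [swap0 1] acts first, as in the product
    [tperm token0 token1 * tperm token0 i]. *)
Lemma carries_ok :
  all (fun i => walk (conjugate (nth [::] carries (i - 2))) start ==
                Some [seq nth 0 start (swap0 i (swap0 1 x)) | x <- iota 0 11])
    (iota 2 9).
Proof. by vm_compute. Qed.

(** * Frozen tokens and the parity invariant *)

Lemma bits_holes l (C : config 4 l) : l <= 16 -> count negb (bits (pos C)) = l.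
Proof.
move=> le_l; apply/eqP; rewrite -(eqn_add2l (count id (bits (pos C)))).
rewrite count_predC.
rewrite size_bits count_map (count_mem_swap (pos_uniq C)) ?iota_uniq //.
have -> : count [in iota 0 16] (pos C) = size (pos C).
  apply/eqP; rewrite -all_count; apply: sub_all (pos_lt C) => x.
  by rewrite mem_iota.
(* Here [l <= 16] makes the truncated subtraction [2 ^ 4 - l] exact. *)
by rewrite size_pos subnK.
Qed.

Lemma config_mask_ok l (C : config 4 l) :
  l <= 5 -> mask_ok signs (bits (pos C)).
Proof.
move=> le_l; apply: (all_bitsP masks_ok); first exact: size_bits.
by rewrite bits_holes // (leq_trans le_l).
Qed.

(** A token outside the region [K] never moves: [K] persists along paths and every moved token
    starts in it. *)
Lemma frozen_token l (C : config 4 l) : l <= 5 ->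
  ~~ lookup signs (bits (pos C)) ->
  exists t, forall D, connect (@puz 4 2 _) C D -> D t = C t.
Proof.
move=> le_l noC; have {noC} def_C : lookup signs (bits (pos C)) = None.
  by case: (lookup _ _) noC.
have := config_mask_ok C le_l; rewrite /mask_ok def_C => /andP[_ /hasP[x]].
rewrite mem_iota => lt_x.
rewrite (nth_bits _ lt_x) => /andP[/posP[t ->]].
move def_K: (region _) => K t_out; exists t => D /connectP[p].
move def_v: (C t) t_out => v t_out.
elim: p C def_C def_K def_v => [|D' p IHp] C def_C def_K def_v /= => [_ -> //|].
case/andP=> /puz_pos[m in_m def_D'] pathp.
have := config_mask_ok C le_l; rewrite /mask_ok def_C.
case/andP=> /allP/(_ m in_m).
rewrite def_K -(bits_pos_step in_m) -def_D'.
case/and3P=> Km /eqP def_K' /eqP def_C' _.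
apply: IHp => //; apply: code_inj.
rewrite -nth_pos def_D' (nth_map 0) ?size_pos // nth_pos def_v.
by case: eqP => // v_m; rewrite v_m Km in t_out.
Qed.

Definition parity l (C : config 4 l) : option bool :=
  omap (addb (inv_parity (pos C))) (lookup signs (bits (pos C))).

(** Each move changes [inv_parity] and the sign of the mask both by [msign], and the changes
    cancel. *)
Lemma parity_connect l (C D : config 4 l) : l <= 5 ->
  lookup signs (bits (pos C)) -> connect (@puz 4 2 _) C D ->
  parity D = parity C.
Proof.
move=> le_l inC /connectP[p].
elim: p C inC => [|E p IHp] C inC /= => [_ -> //|].
case/andP=> /puz_pos[m in_m def_E] pathp def_D.
have [u_C w_C _ _] := moves_pos in_m.
have [e def_e] : exists e, lookup signs (bits (pos C)) = Some e.
  by case: (lookup _ _) inC => // e; exists e.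
have := config_mask_ok C le_l; rewrite /mask_ok def_e => /allP/(_ m in_m).
rewrite -(bits_pos_step in_m) -def_E => /eqP def_e'.
rewrite (IHp E) ?def_e' // /parity def_e def_e' def_E /=; congr Some.
case: m in_m u_C w_C {def_E def_e'} => u w in_m u_C w_C.
rewrite inv_parity_step ?pos_uniq //.
have -> : msign (bits (pos C)) (u, w) = odd (count [in between (u, w)] (pos C)).
  rewrite -count_mem_swap ?iota_uniq ?pos_uniq //; congr odd.
  apply: eq_in_count => x; rewrite mem_iota => /andP[_ lt_x].
  have [_ _ lt_w _] := moves_pos in_m.
  rewrite nth_bits //; have := allP (pos_lt C) _ u_C.
  by move: lt_w lt_x => /=; lia.
by case: (inv_parity _) (odd _) e {def_e} => [] [] [].
Qed.

(** * Relabellings and generation of even permutations *)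

Lemma relabelE d l g (C : config d l) t : relabel g C t = C (g t).
Proof. by rewrite ffunE. Qed.

Lemma relabel1 d l (C : config d l) : relabel 1 C = C.
Proof. by apply/val_inj/ffunP=> t; rewrite relabelE perm1. Qed.

Lemma relabelM d l g h (C : config d l) :
  relabel h (relabel g C) = relabel (h * g) C.
Proof. by apply/val_inj/ffunP=> t; rewrite !relabelE permM. Qed.

Lemma puz_relabel d k l g (C D : config d l) :
  puz k C D -> puz k (relabel g C) (relabel g D).
Proof.
case/existsP=> t /existsP[F /and5P[faceF Ct Dt neq]].
case/andP=> /forallP offF /forallP fixed.
(* In [relabel g C], the token standing where [t] stands in [C] is [g^-1%g t]. *)
apply/existsP; exists (g^-1%g t); apply/existsP; exists F.
rewrite faceF !relabelE permKV Ct Dt neq /=.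
apply/andP; split; apply/forallP=> s; rewrite !relabelE; apply/implyP=> st.
  by apply: (implyP (offF (g s))); rewrite -(inj_eq (@perm_inj _ g^-1%g)) permK.
by apply: (implyP (fixed (g s))); rewrite -(inj_eq (@perm_inj _ g^-1%g)) permK.
Qed.

Lemma connect_relabel d k l g (C D : config d l) :
  connect (@puz d k l) C D -> connect (@puz d k l) (relabel g C) (relabel g D).
Proof.
case/connectP=> p; elim: p C => [|E p IHp] C /= => [_ -> //|].
case/andP=> /(puz_relabel g) CE pathp def_D.
exact: connect_trans (connect1 CE) (IHp _ pathp def_D).
Qed.

Lemma puz_connect_sym d k l : connect_sym (@puz d k l).
Proof. exact/sym_connect_sym/puz_sym. Qed.

Lemma same_occupied d l (C D : config d l) :
  codom C =i codom D -> exists g, C = relabel g D.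
Proof.
move=> eqCD; have inD t : C t \in codom D by rewrite -eqCD codom_f.
pose f t := iinv (inD t); have f_inj : injective f.
  move=> s t eq_f; apply: (@config_fun_inj _ _ C).
  by rewrite -(f_iinv (inD s)) -(f_iinv (inD t)) -/(f s) eq_f.
by exists (perm f_inj); apply/val_inj/ffunP=> t; rewrite relabelE permE f_iinv.
Qed.

(* The transpositions [tperm x z] generate the symmetric group, and an even
   product of them is a product of the pairs [tperm x a * tperm x b], each of
   which is [(tperm x y * tperm x a)^-1 * (tperm x y * tperm x b)]. *)
Lemma even_perm_ind (T : finType) (x y : T) (P : {perm T} -> Prop) :
  P 1%g -> (forall g h, P g -> P h -> P (g * h)%g) ->
  (forall g, P g -> P g^-1%g) ->
  (forall z, z != x -> P (tperm x y * tperm x z)%g) ->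
  forall g, ~~ odd_perm g -> P g.
Proof.
move=> P1 PM PV P3 g.
have star : exists2 s : seq T, x \notin s & g = (\prod_(z <- s) tperm x z)%g.
  have [ts -> {g}] := prod_tpermP g.
  elim: ts => [|[a b] ts IHts] /=; first by exists [::]; rewrite ?big_nil.
  case/andP=> /= neq_ab /IHts[s xs def_s]; rewrite big_cons def_s /=.
  have [def_a | neq_a] := eqVneq a x.
    exists (b :: s); last by rewrite big_cons def_a.
    by rewrite inE negb_or xs -def_a; move: neq_ab; rewrite /dpair /= => ->.
  have [def_b | neq_b] := eqVneq b x.
    exists (a :: s); last by rewrite big_cons def_b tpermC.
    by rewrite inE negb_or xs eq_sym neq_a.
  (* [tperm a b] is the conjugate of [tperm x b] by [tperm x a]. *)
  exists [:: a, b, a & s].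
    by rewrite !inE !negb_or ![x == _]eq_sym neq_a neq_b.
  rewrite !big_cons !mulgA; congr (_ * _)%g.
  rewrite -[in RHS]mulgA -{1}(tpermV x a) -conjgE tpermJ tpermL.
  by rewrite tpermD // eq_sym.
case: star => s xs -> {g}; have [n] := ubnP (size s).
elim: n s xs => // n IHn [|a [|b s]]; rewrite ?big_nil // !inE ?negb_or.
  by rewrite big_seq1 odd_tperm => ->.
case/and3P=> ax bx xs size_s; rewrite !big_cons mulgA.
rewrite !odd_permM !odd_tperm ax bx /=.
move=> even_s; apply: (PM); last exact: IHn xs (ltnW size_s) even_s.
rewrite -[tperm x b](mulKg (tperm x y)) mulgA; apply: (PM); last first.
  by apply: P3; rewrite eq_sym.
rewrite -[tperm x a]invgK -invMg tpermV.
by apply/PV/P3; rewrite eq_sym.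
Qed.

Lemma three_cycle_moving (T : finType) (t : T) : 2 < #|T| ->
  exists2 g : {perm T}, ~~ odd_perm g & g t != t.
Proof.
move=> gt2; have [a neq_a] : exists a, a \in ~: [set t].
  by apply/card_gt0P; rewrite cardsC1; case: #|T| gt2 => [|[]].
have [b neq_b] : exists b, b \in ~: [set t; a].
  apply/card_gt0P; rewrite -(ltn_add2l #|[set t; a]|) cardsC addn0 cards2.
  by apply: leq_ltn_trans gt2; case: (t != a).
move: neq_a neq_b; rewrite !inE negb_or => neq_a /andP[neq_bt neq_ba].
exists (tperm t a * tperm t b)%g.
  by rewrite odd_permM !odd_tperm !(eq_sym t) neq_a neq_bt.
by rewrite permM tpermL tpermD // eq_sym.
Qed.

(** Contradicts a frozen token when [l <= 4], and yields mobility when [l] is 5. *)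
Lemma even_orbit_moving l (C : config 4 l) (t : token 4 l) : 2 < 2 ^ 4 - l ->
  (forall g, ~~ odd_perm g -> connect (@puz 4 2 _) C (relabel g C)) ->
  exists2 D, connect (@puz 4 2 _) C D & D t != C t.
Proof.
move=> gt2 evenC; have [|g even_g neq] := @three_cycle_moving _ t.
  by rewrite card_ord.
exists (relabel g C); first exact: evenC.
by rewrite relabelE (inj_eq (@config_fun_inj _ _ C)).
Qed.

(** * Reachability of masks and the lower bound on [l] *)

Lemma reachable_mask (C0 : config 4 5) b : pos C0 = start -> lookup signs b ->
  exists2 D, connect (@puz 4 2 _) C0 D & bits (pos D) = b.
Proof.
move=> def_C0; rewrite /signs -lock; move: b.
(* The inductive property is being the mask of a configuration reachable from [C0]. *)
apply: explore_ind => [b m [D C0D def_b] in_m | // | x].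
  rewrite -def_b in in_m; have [E DE def_E] := puz_step in_m.
  exists E; first exact: connect_trans C0D (connect1 DE).
  by rewrite def_E (bits_pos_step in_m) def_b.
by rewrite inE => /eqP->; exists C0; rewrite ?def_C0 ?connect0.
Qed.

Lemma start_config : exists C0 : config 4 5, pos C0 = start.
Proof. exact: of_pos. Qed.

Lemma not_even_solvable l : l <= 4 -> ~~ even_solvable 4 2 l.
Proof.
move=> l_le4; apply/existsP=> -[C /forallP evenC].
have gt2 : 2 < 2 ^ 4 - l by rewrite (_ : 2 ^ 4 = 16) //; lia.
(* Signed masks are reachable from [start], so they have five holes, unlike [C]. *)
have noC : ~~ lookup signs (bits (pos C)).
  apply/negP=> inC; have [C0 def_C0] := start_config.
  have [D _ eq_bits] := reachable_mask def_C0 inC.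
  have := bits_holes C; rewrite -eq_bits bits_holes //; lia.
have [|t frozen] := frozen_token _ noC; first exact: leq_trans l_le4 _.
have [g even_g|D CD /eqP[]] := even_orbit_moving t gt2 (C := C).
  by have := implyP (evenC g) even_g; rewrite inE.
exact: frozen.
Qed.

(** * Even and odd relabellings of the start *)

Lemma walk_connect l (C : config 4 l) w s : walk w (pos C) = Some s ->
  exists2 D, connect (@puz 4 2 _) C D & pos D = s.
Proof.
elim: w C => [|m w IHw] C /=; first by case=> <-; exists C; rewrite ?connect0.
case: ifP => // /puz_step[D CD <-] /IHw[E DE <-].
by exists E; rewrite // (connect_trans (connect1 CD)).
Qed.

Lemma pos_relabel (C : config 4 5) (g : {perm token 4 5}) (f : nat -> nat) s :
  pos C = s -> (forall t, g t = f t :> nat) ->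
  pos (relabel g C) = [seq nth 0 s (f x) | x <- iota 0 11].
Proof.
move=> <- def_g; apply: (@eq_from_nth _ 0) => [|x].
  by rewrite size_pos size_map size_iota.
rewrite size_pos => lt_x; rewrite (nth_map 0) ?size_iota // nth_iota //.
by rewrite -[x]/(nat_of_ord (Ordinal lt_x)) nth_pos relabelE -def_g nth_pos.
Qed.

Definition token0 : token 4 5 := @Ordinal (2 ^ 4 - 5) 0 isT.
Definition token1 : token 4 5 := @Ordinal (2 ^ 4 - 5) 1 isT.

Lemma tperm_swap0 (i t : token 4 5) : tperm token0 i t = swap0 i t :> nat.
Proof.
rewrite permE /= /swap0 -!val_eqE /=.
by case: ifP => //; case: ifP.
Qed.

Lemma start_three_cycle (C0 : config 4 5) (i : token 4 5) : pos C0 = start ->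
  i != token0 ->
  connect (@puz 4 2 _) C0 (relabel (tperm token0 token1 * tperm token0 i) C0).
Proof.
move=> def_C0 i_neq0; have [->|i_neq1] := eqVneq i token1.
  by rewrite tperm2 relabel1 connect0.
have : nat_of_ord i \in iota 2 9.
  by move: i_neq0 i_neq1 (ltn_ord i); rewrite mem_iota -!val_eqE /=; lia.
move/(allP carries_ok)/eqP; rewrite -[X in walk _ X]def_C0.
case/walk_connect=> D C0D def_D.
rewrite (_ : relabel _ _ = D) //; apply: pos_inj; rewrite def_D.
rewrite (@pos_relabel _ _ (fun x => swap0 i (swap0 1 x)) _ def_C0) // => t.
by rewrite permM !tperm_swap0.
Qed.

(** The permutations realized from [C0] are closed under product and inverse, because moves commute
    with relabelling and are reversible. *)
Lemma start_even (C0 : config 4 5) (g : {perm token 4 5}) : pos C0 = start ->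
  ~~ odd_perm g -> connect (@puz 4 2 _) C0 (relabel g C0).
Proof.
move=> def_C0; move: g; apply: (even_perm_ind (x := token0) (y := token1)).
- by rewrite relabel1 connect0.
- move=> g h C0g /(connect_relabel g) + ; rewrite relabelM.
  exact: connect_trans.
- move=> g /(connect_relabel g^-1%g); rewrite relabelM mulVg relabel1.
  by rewrite puz_connect_sym.
by move=> i; apply: start_three_cycle.
Qed.

(** Relabelling by the transposition turns the walk for the even product [tperm token0 token1 * g]
    into the required one. *)
Lemma start_odd (C0 : config 4 5) (g : {perm token 4 5}) : pos C0 = start ->
  odd_perm g ->
  connect (@puz 4 2 _) (relabel (tperm token0 token1) C0) (relabel g C0).
Proof.
move=> def_C0 odd_g; have := @start_even _ (tperm token0 token1 * g)%g def_C0.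
rewrite odd_permM odd_tperm odd_g => /(_ isT).
move/(connect_relabel (tperm token0 token1)).
by rewrite relabelM mulgA tperm2 mul1g.
Qed.

(** * Mobile configurations and their components *)

Lemma even_mobile (C : config 4 5) :
  (forall g, ~~ odd_perm g -> connect (@puz 4 2 _) C (relabel g C)) ->
  mobile 2 C.
Proof.
move=> evenC; apply/andP; split.
  have [//|D + neq] := even_orbit_moving token0 _ evenC.
  case/connectP=> [[|E p]] /= CE def_D.
    by rewrite def_D eqxx in neq.
  case/andP: CE => /existsP[t CE] _.
  by apply/forallP=> /(_ t)/forallP/(_ E); rewrite CE.
apply/existsP=> -[A /and3P[/set0Pn[t At] _ /forall_inP avoid]].
(* Some even relabelling moves [t], while a path avoiding [A] keeps it in place. *)
have [|D CD neq] := even_orbit_moving t _ evenC => //.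
have /connectP[p pathp def_D] := avoid D (etrans (in_set _ _) CD).
case/eqP: neq; rewrite {}def_D {CD avoid evenC D}.
elim: p C pathp => //= E p IHp C /andP[/exists_inP[s]]; rewrite inE => sA.
case/existsP=> F /and5P[_ _ _ _ /andP[_ /forallP/(_ t)/implyP fixed]] /IHp->.
by apply/eqP/fixed; apply: contraTneq At => ->.
Qed.

(** A frozen token alone forms the set witnessing semi-isolation, proper among eleven tokens. *)
Lemma mobile_signed (C : config 4 5) :
  mobile 2 C -> lookup signs (bits (pos C)).
Proof.
case/andP=> _; apply: contraNT => noC.
have [//|t frozen] := frozen_token _ noC.
apply/existsP; exists [set t]; apply/and3P; split.
- by apply/set0Pn; exists t; rewrite inE.
- by rewrite properEcard subsetT cards1 cardsT card_ord.
suff avoid p E : connect (@puz 4 2 5) C E -> path (@puz 4 2 5) E p ->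
    connect (puz_avoiding 2 [set t]) E (last E p).
  apply/forall_inP=> D; rewrite inE => /connectP[p pathp ->].
  exact: avoid (connect0 _ _) pathp.
elim: p E => [|E' p IHp] E CE /=; first by rewrite connect0.
case/andP=> EE' pathp; have CE' := connect_trans CE (connect1 EE').
apply: connect_trans (connect1 _) (IHp E' CE' pathp).
case/existsP: EE' => s sEE'; apply/exists_inP; exists s => //; rewrite !inE.
apply: contraTneq sEE' => ->; apply/existsP=> -[F /and5P[_ _ _ neq _]].
by rewrite !frozen // eqxx in neq.
Qed.

(** Some [D] reachable from [C0] has the mask of [C], so [C] is [relabel g D]; the parity of [g]
    selects the component. *)
Lemma start_reach (C0 C : config 4 5) : pos C0 = start ->
  lookup signs (bits (pos C)) ->
  connect (@puz 4 2 _) C0 C \/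
  connect (@puz 4 2 _) (relabel (tperm token0 token1) C0) C.
Proof.
move=> def_C0 /(reachable_mask def_C0)[D C0D eq_bits].
have [g def_C] : exists g, C = relabel g D.
  apply: same_occupied => v.
  have occ (E : config 4 5) :
      (v \in codom E) = nth false (bits (pos E)) (code v).
    rewrite nth_bits ?code_lt //; apply/codomP/posP=> -[t].
      by move->; exists t.
    by move/code_inj->; exists t.
  by rewrite !occ eq_bits.
have {C0D} := connect_relabel g C0D; rewrite -def_C => gC.
have [odd_g | even_g] := boolP (odd_perm g); last first.
  by left; apply: connect_trans gC; apply: start_even.
by right; apply: connect_trans gC; apply: start_odd.
Qed.

Theorem theorem1p18 : Smin 4 2 = 5 /\ strong_parity 4 2 (Smin 4 2).
Proof.
have [C0 def_C0] := start_config.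
have even_C0 g : ~~ odd_perm g -> connect (@puz 4 2 _) C0 (relabel g C0).
  exact: start_even.
have S5 : Smin 4 2 = 5.
  rewrite /Smin; case: ex_minnP => l /andP[/andP[_ _] solv_l] min_l.
  apply/eqP; rewrite eqn_leq min_l /=; last first.
    apply/existsP; exists C0; apply/forallP=> g; apply/implyP=> even_g.
    by rewrite inE even_C0.
  by rewrite ltnNge; apply: contraL solv_l; apply: not_even_solvable.
split=> //; rewrite S5.
set C1 := relabel (tperm token0 token1) C0.
have even_C1 g : ~~ odd_perm g -> connect (@puz 4 2 _) C1 (relabel g C1).
  move=> even_g; rewrite relabelM start_odd //.
  by rewrite odd_permM odd_tperm (negPf even_g).
(* Both have the mask of [start], but [C1] has one inversion and [C0] none. *)
have apart : ~~ connect (@puz 4 2 _) C0 C1.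
  have def_C1 : pos C1 = [:: 1; 0; 2; 4; 8; 9; 10; 11; 12; 13; 14].
    by apply: (pos_relabel (f := swap0 1) def_C0) => t; rewrite tperm_swap0.
  apply/negP=> /(parity_connect (isT : 5 <= 5)).
  rewrite /parity def_C0 def_C1 (_ : bits [:: 1, 0 & _] = bits start) //.
  by rewrite signs_start => /(_ isT).
rewrite /strong_parity.
(* [start_reach] leaves no third component, and [even_mobile] makes both of these count. *)
rewrite (_ : [set _ | _ in _] = [set component 2 C0; component 2 C1]).
  rewrite cards2; apply/eqP; congr _.+1; apply/eqP; rewrite eqb1.
  apply: contra apart => /eqP/setP/(_ C1).
  by rewrite !inE connect0 => ->.
have same C D : connect (@puz 4 2 5) C D -> component 2 C = component 2 D.
  move=> CD; apply/setP=> E; rewrite !inE.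
  exact: (same_connect (@puz_connect_sym _ _ _) CD).
apply/setP=> X; rewrite !inE; apply/imsetP/orP=> [[C mobC ->] | ].
  have signC : lookup signs (bits (pos C)).
    by apply: mobile_signed; rewrite inE in mobC.
  by case: (start_reach def_C0 signC) => /same->; [left | right].
case=> /eqP->; [exists C0 | exists C1] => //; rewrite inE; exact: even_mobile.
Qed.
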